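(* Let $\epsilon_j(\xi,t)=U_j-u_j$ be the error on cell $I_j$ (mapped to $[-1,1]$) of the degree-$p$ upwind discontinuous Galerkin solution on a uniform mesh of size $h$ for a smooth periodic solution $u$ of $u_t+au_x=0$, $a>0$, and suppose the error has the superconvergent form $$\epsilon_j(\xi,t)=\frac{(-1)^{p+1}}{2}[[U_j]]\,R^-_{p+1}(\xi)+\alpha_{p+2}(t)R^{-,(-1)}_{p+1}(\xi)+\dots+\alpha_{2p+1}(t)R^{-,(-p)}_{p+1}(\xi)+\mathcal{O}(h^{2p+1}),\qquad \alpha_k(t)=\mathcal{O}(h^k).$$ Then the $m$-th moment of the error is of order $2p+1-m$, i.e. $$\int_{-1}^1\epsilon_j(\xi,t)P_m(\xi)\,d\xi=\mathcal{O}(h^{2p+1-m}),\qquad m=0,\dots,p.$$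
   Context: $P_k$ is the Legendre polynomial of degree $k$ on $[-1,1]$ with $P_k(1)=1$; $R^-_{p+1}=P_{p+1}-P_p$ is the right Radau polynomial, with repeated integrals $R^{-,(0)}_{p+1}=R^-_{p+1}$, $R^{-,(-(k+1))}_{p+1}(\xi)=\int_{-1}^\xi R^{-,(-k)}_{p+1}(s)\,ds$. On each cell $I_j=[x_j,x_{j+1}]$, $x_{j+1}-x_j=h$, mapped to $[-1,1]$ by $x(\xi)=\frac{x_j+x_{j+1}}{2}+\frac h2\xi$, $u_j(\xi,t)=u(x(\xi),t)$ and $U_j(\xi,t)=\sum_{k=0}^pc_{jk}(t)P_k(\xi)$ solves $$\frac{d}{dt}c_{jk}+\frac{(2k+1)a}{h}\int_{-1}^1\frac{\partial U_j}{\partial\xi}P_k\,d\xi=-\frac{(2k+1)a}{h}(-1)^k[[U_j]],\quad k=0,\dots,p,$$ with jump $[[U_j]]=U_j(-1,t)-U_{j-1}(1,t)$ and periodic indices. As $u$ is smooth, the numerical solution is order $p+1$ accurate and the jump satisfies $[[U_j]]=\mathcal{O}(h^{p+1})$. $\mathcal{O}(\cdot)$ refers to $h\to0$, uniformly in $\xi\in[-1,1]$. *)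

(* Defs.v *)
From HB Require Import structures.
From mathcomp Require Import all_boot all_order all_algebra.
From mathcomp Require Import all_classical all_reals all_analysis.

Set Implicit Arguments.
Unset Strict Implicit.
Unset Printing Implicit Defensive.

Import Order.TTheory GRing.Theory Num.Theory.
Import numFieldNormedType.Exports.

Local Open Scope classical_set_scope.
Local Open Scope ring_scope.

(* Rodrigues' formula; this normalization gives P_k(1) = 1. *)
Definition legendre (R : realType) (k : nat) : {poly R} :=
  ((2 ^ k * k`!)%:R)^-1 *: (('X^2 - 1) ^+ k)^`(k).

(* R^-_{p+1}, indexed by p *)
Definition radau (R : realType) (p : nat) : {poly R} :=
  legendre R p.+1 - legendre R p.

(* [radau_int R p k] is R^{-,(-k)}_{p+1}, meant on [-1, 1] only: for xi < -1
   the integration domain below is empty. *)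
Fixpoint radau_int (R : realType) (p k : nat) : R -> R :=
  match k with
  | 0 => fun xi => (radau R p).[xi]
  | k'.+1 => fun xi =>
      \int[lebesgue_measure]_(s in `[(-1 : R), xi]) radau_int p k' s
  end.

Fixpoint Ck (R : realType) (k : nat) (f : R -> R -> R) : Prop :=
  continuous (fun z : R * R => f z.1 z.2) /\
  match k with
  | 0 => True
  | k'.+1 =>
      [/\ forall x t, derivable (f ^~ t) x 1,
          forall x t, derivable (f x) t 1,
          Ck k' (fun x t => derive1 (f ^~ t) x)
        & Ck k' (fun x t => derive1 (f x) t)]
  end.

Definition smooth (R : realType) (f : R -> R -> R) : Prop :=
  forall k, Ck k f.

(* [u x t] is defined for every real t, but only its values at t >= 0 matter:
   a solution smooth up to t = 0 is the restriction of such a function. *)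
Definition smooth_periodic_advection (R : realType) (a L : R)
    (u : R -> R -> R) : Prop :=
  [/\ smooth u,
      forall x t, 0 <= t -> u (x + L) t = u x t
    & forall x t, 0 <= t -> derive1 (u x) t + a * derive1 (u ^~ t) x = 0].

(* The period [x0, x0 + L] is cut into n.+1 equal cells I_j, j : 'I_n.+1. *)
Definition mesh_size (R : realType) (L : R) (n : nat) : R := L / n.+1%:R.

Definition node (R : realType) (x0 L : R) (n i : nat) : R :=
  x0 + i%:R * mesh_size L n.

Definition cell_map (R : realType) (x0 L : R) (n : nat) (j : 'I_n.+1)
    (xi : R) : R :=
  (node x0 L n j + node x0 L n j.+1) / 2 + mesh_size L n / 2 * xi.

(* U_j(., t), as a polynomial in xi *)
Definition dg_poly (R : realType) (p n : nat)
    (c : 'I_n.+1 -> 'I_p.+1 -> R -> R) (j : 'I_n.+1) (t : R) : {poly R} :=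
  \sum_(k < p.+1) c j k t *: legendre R k.

(* [ord_pred] is the cyclic predecessor, so that U_{-1} is U_n. *)
Definition jump (R : realType) (p n : nat)
    (c : 'I_n.+1 -> 'I_p.+1 -> R -> R) (j : 'I_n.+1) (t : R) : R :=
  (dg_poly c j t).[-1] - (dg_poly c (ord_pred j) t).[1].

Definition dg_solution (R : realType) (p : nat) (a L : R) (n : nat)
    (c : 'I_n.+1 -> 'I_p.+1 -> R -> R) : Prop :=
  forall (j : 'I_n.+1) (k : 'I_p.+1),
    {within `[0, +oo[, continuous (c j k)} /\
    forall t : R, 0 < t ->
      derivable (c j k) t 1 /\
      derive1 (c j k) t
        + (2 * k + 1)%:R * a / mesh_size L n
          * \int[lebesgue_measure]_(xi in `[(-1 : R), 1])
              ((dg_poly c j t)^`().[xi] * (legendre R k).[xi])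
      = - ((2 * k + 1)%:R * a / mesh_size L n) * (-1) ^+ k * jump c j t.

Definition dg_error (R : realType) (p : nat) (x0 L : R) (u : R -> R -> R)
    (n : nat) (c : 'I_n.+1 -> 'I_p.+1 -> R -> R) (j : 'I_n.+1)
    (xi t : R) : R :=
  (dg_poly c j t).[xi] - u (cell_map x0 L j xi) t.

(* f = O(h^q) as h -> 0, uniformly in xi in [-1, 1] and over the set W of
   (mesh, cell, time) triples.  W may fix the time and one cell per mesh, or
   contain all the cells and a whole range of times. *)
Definition unif_bigO_xi (R : realType) (L : R) (W : forall n, 'I_n.+1 -> R -> Prop)
    (q : nat) (f : forall n, 'I_n.+1 -> R -> R -> R) : Prop :=
  exists C delta : R, 0 < delta /\
    forall (n : nat) (j : 'I_n.+1) (t : R), W n j t -> mesh_size L n < delta ->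
    forall xi : R, -1 <= xi <= 1 -> `|f n j xi t| <= C * mesh_size L n ^+ q.

Definition unif_bigO (R : realType) (L : R) (W : forall n, 'I_n.+1 -> R -> Prop)
    (q : nat) (f : forall n, 'I_n.+1 -> R -> R) : Prop :=
  exists C delta : R, 0 < delta /\
    forall (n : nat) (j : 'I_n.+1) (t : R), W n j t -> mesh_size L n < delta ->
    `|f n j t| <= C * mesh_size L n ^+ q.

(* Main.v *)
Require Import Defs.
From mathcomp Require Import all_boot all_order all_algebra.
From mathcomp Require Import all_classical all_reals all_analysis.
From mathcomp Require Import zify ring lra.

Set Implicit Arguments.
Unset Strict Implicit.
Unset Printing Implicit Defensive.

Import Order.TTheory GRing.Theory Num.Theory.
Import numFieldNormedType.Exports.

Local Open Scope classical_set_scope.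
Local Open Scope ring_scope.

(** Integrate the expansion of the error against P_m term by term.

    By Rodrigues' formula the right Radau polynomial is a combination of the
    derivatives of orders p+1 and p of (X^2-1)^(p+1) and (X^2-1)^p.  As both
    powers vanish at -1 to high order, its k-th repeated integral from -1 is
    obtained by lowering the two orders of differentiation by k: this is
    [radau_poly p k], and [radau_int_horner] identifies it with the analytic
    iterated integral.

    For j <= n, integrating by parts j times shows that the j-th derivative of
    (X^2-1)^n is orthogonal on [-1, 1] to every polynomial of degree less than
    j, the boundary terms being zero.  Therefore the k-th repeated
    integral is orthogonal to P_m as soon as m + k < p
    ([poly_moment_radau]).

    So a term of index k >= 1 contributes to the m-th moment only if
    k >= p - m, and its coefficient alpha_{p+1+k} is then O(h^(p+1+k)), hence
    O(h^(2p+1-m)).  The jump term, of index k = 0, contributes only if m = p,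
    where the required order is p+1, the order of the jump.  The remainder
    O(h^(2p+1)) is uniform in xi and P_m is bounded, so its moment keeps that
    order ([unif_bigO_moment]). *)

(** * Derivatives of powers of a polynomial *)

Lemma size_derivn_leq (R : nzSemiRingType) (p : {poly R}) n :
  (size p^`(n) <= size p - n)%N.
Proof.
by apply/leq_sizeP => i hi; rewrite coef_derivn nth_default ?mul0rn// -leq_subLR.
Qed.

Lemma derivn_exp_factor (R : comNzRingType) (w : {poly R}) n j : (j <= n)%N ->
  exists r, (w ^+ n)^`(j) = w ^+ (n - j) * r.
Proof.
elim: j => [_|j IH jn]; first by exists 1; rewrite mulr1 derivn0 subn0.
have [r Er] := IH (ltnW jn).
exists (w^`() * r *+ (n - j) + w * r^`()).
rewrite derivnS Er derivM deriv_exp.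
have -> : (n - j = (n - j.+1).+1)%N by lia.
by rewrite /= exprS mulrDr mulrnAl mulrnAr; congr (_ *+ _ + _);
  rewrite -mulrA mulrCA.
Qed.

Lemma derivn_exp_root (R : comNzRingType) (w : {poly R}) x n j :
  (j < n)%N -> w.[x] = 0 -> (w ^+ n)^`(j).[x] = 0.
Proof.
move=> jn wx; have [r ->] := derivn_exp_factor w (ltnW jn).
by rewrite hornerM horner_exp wx expr0n subn_eq0 leqNgt jn mul0r.
Qed.

(** Integration by parts j times, phrased algebraically: each step moves one
    derivative from the power of w to q and leaves a boundary term that
    vanishes at the roots of w; after j steps q has been differentiated to 0. *)
Lemma derivn_exp_mul_primitive (R : comNzRingType) (w q : {poly R}) a b n j :
  w.[a] = 0 -> w.[b] = 0 -> (j <= n)%N -> (size q <= j)%N ->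
  exists S, [/\ S^`() = (w ^+ n)^`(j) * q, S.[a] = 0 & S.[b] = 0].
Proof.
move=> wa wb; elim: j q => [|j IH] q jn.
  rewrite leqn0 size_poly_eq0 => /eqP->.
  by exists 0; rewrite mulr0 deriv0 !horner0.
move=> sq; have [|S [dS Sa Sb]] := IH q^`() (ltnW jn).
  by have := size_derivn_leq q 1; rewrite derivn1; lia.
exists ((w ^+ n)^`(j) * q - S); split.
- by rewrite derivB derivM dS -derivnS addrK.
- by rewrite hornerD hornerN hornerM derivn_exp_root// mul0r Sa subr0.
- by rewrite hornerD hornerN hornerM derivn_exp_root// mul0r Sb subr0.
Qed.

(** * Integrals over [-1, 1] *)

Section Integrals.
Variable R : realType.
Notation mu := lebesgue_measure.

Lemma continuous_integrable_segment (f : R -> R) a b : continuous f ->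
  mu.-integrable `[a, b] (EFin \o f).
Proof.
move=> cf; apply: continuous_compact_integrable; first exact: segment_compact.
exact: continuous_subspaceT.
Qed.

Lemma Rintegral_deriv (q : {poly R}) a b : a <= b ->
  \int[mu]_(x in `[a, b]) q^`().[x] = q.[b] - q.[a].
Proof.
rewrite le_eqVlt => /predU1P[->|ab]; first by rewrite set_itv1 Rintegral_set1 subrr.
rewrite /Rintegral (@continuous_FTC2 _ _ (horner q) _ _ ab)//=.
- exact/continuous_subspaceT/continuous_horner.
- split=> [x _||]; first exact: derivable_horner.
  + exact/cvg_at_right_filter/continuous_horner.
  + exact/cvg_at_left_filter/continuous_horner.
- by move=> x _; rewrite derivE.
Qed.

Lemma norm_horner_le (q : {poly R}) x : -1 <= x <= 1 ->
  `|q.[x]| <= \sum_(i < size q) `|q`_i|.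
Proof.
move=> hx; rewrite horner_coef (le_trans (ler_norm_sum _ _ _))// ler_sum// => i _.
rewrite normrM normrX ler_piMr// exprn_ile1// ler_norml//.
Qed.

Lemma norm_Rintegral_le (f : R -> R) (K : R) : continuous f ->
  (forall x : R, -1 <= x <= 1 -> `|f x| <= K) ->
  `|\int[mu]_(x in `[(-1 : R), 1]) f x| <= K * 2.
Proof.
move=> cf fK.
have mI : measurable (`[(-1 : R), 1] : set (measurableTypeR R)) by [].
have fI := continuous_integrable_segment (-1) 1 cf.
apply: le_trans (le_normr_Rintegral mI fI) _.
have -> : K * 2 = \int[mu]_(x in `[(-1 : R), 1]) K.
  rewrite Rintegral_cst//= lebesgue_measure_itv/= lte_fin ifT; last lra.
  by rewrite opprK.
apply: le_Rintegral => //.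
- apply: continuous_integrable_segment => x.
  by apply: cvg_norm; exact: cf.
- by apply: continuous_integrable_segment => x; exact: cvg_cst.
Qed.

Definition poly_moment (m : nat) (q : {poly R}) : R :=
  \int[mu]_(x in `[(-1 : R), 1]) (q * legendre R m).[x].

Let integrable_horner (q : {poly R}) :
  mu.-integrable `[(-1 : R), 1] (EFin \o horner q).
Proof. exact/continuous_integrable_segment/continuous_horner. Qed.

Lemma poly_momentD m q1 q2 :
  poly_moment m (q1 + q2) = poly_moment m q1 + poly_moment m q2.
Proof.
rewrite /poly_moment mulrDl -RintegralD//.
by apply: eq_Rintegral => x _; rewrite hornerD.
Qed.

Lemma poly_momentZ m k q : poly_moment m (k *: q) = k * poly_moment m q.
Proof.
rewrite /poly_moment -scalerAl -RintegralZl//.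
by apply: eq_Rintegral => x _; rewrite hornerZ.
Qed.

Lemma poly_moment_sum m (I : Type) (r : seq I) (P : pred I) (F : I -> {poly R}) :
  poly_moment m (\sum_(i <- r | P i) F i) = \sum_(i <- r | P i) poly_moment m (F i).
Proof.
apply: (big_morph (poly_moment m) (@poly_momentD m)).
by rewrite -[X in poly_moment m X](scale0r 0) poly_momentZ mul0r.
Qed.

(** * Orthogonality of the repeated integrals of the Radau polynomial *)

Lemma X2B1_root1 : ('X^2 - 1 : {poly R}).[1] = 0.
Proof. by rewrite !hornerE expr1n subrr. Qed.

Lemma X2B1_rootN1 : ('X^2 - 1 : {poly R}).[-1] = 0.
Proof. by rewrite !hornerE sqrrN expr1n subrr. Qed.

Lemma size_legendre m : (size (legendre R m) <= m.+1)%N.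
Proof.
rewrite (leq_trans (size_scale_leq _ _))// (leq_trans (size_derivn_leq _ _))//.
have := size_poly_exp_leq ('X^2 - 1 : {poly R}) m.
by rewrite size_XnsubC//= leq_subLR => /leq_trans; apply; lia.
Qed.

Lemma poly_moment_derivn_exp m n j : (j <= n)%N -> (m < j)%N ->
  poly_moment m (('X^2 - 1) ^+ n)^`(j) = 0.
Proof.
move=> jn mj; rewrite /poly_moment.
have [S [<- S1 S2]] := derivn_exp_mul_primitive X2B1_rootN1 X2B1_root1 jn
  (leq_trans (size_legendre m) mj).
by rewrite Rintegral_deriv ?S1 ?S2 ?subrr//; lra.
Qed.

(** The k-th repeated integral of the Radau polynomial in closed form.  It is
    meaningful for k <= p only: beyond that the truncated subtraction p - k
    stops lowering the order of differentiation. *)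
Definition radau_poly (p k : nat) : {poly R} :=
  ((2 ^ p.+1 * p.+1`!)%:R)^-1 *: (('X^2 - 1) ^+ p.+1)^`(p.+1 - k)
  - ((2 ^ p * p`!)%:R)^-1 *: (('X^2 - 1) ^+ p)^`(p - k).

Lemma radau_poly0 p : radau_poly p 0 = radau R p.
Proof. by rewrite /radau_poly !subn0. Qed.

Lemma deriv_radau_poly p k : (k < p)%N ->
  (radau_poly p k.+1)^`() = radau_poly p k.
Proof.
move=> kp; rewrite /radau_poly derivB !derivZ -!derivnS.
by congr (_ *: _^`(_) - _ *: _^`(_)); lia.
Qed.

(** This fixes the integration constant: a derivative of (X^2-1)^n of order
    less than n vanishes at -1. *)
Lemma radau_poly_N1 p k : (k < p)%N -> (radau_poly p k.+1).[-1] = 0.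
Proof.
move=> kp; rewrite hornerD hornerN !hornerZ !derivn_exp_root ?X2B1_rootN1//; try lia.
by rewrite !mulr0 subr0.
Qed.

Lemma radau_int_horner p k x : (k <= p)%N -> -1 <= x ->
  radau_int p k x = (radau_poly p k).[x].
Proof.
elim: k x => [|k IH] x kp x1 /=; first by rewrite radau_poly0.
rewrite -[RHS]subr0 -(radau_poly_N1 kp) -Rintegral_deriv//.
apply: eq_Rintegral => s; rewrite inE/= in_itv/= => /andP[s1 _].
by rewrite deriv_radau_poly// IH// ltnW.
Qed.

Lemma poly_moment_radau p k m : (m + k < p)%N ->
  poly_moment m (radau_poly p k) = 0.
Proof.
move=> mkp; rewrite /radau_poly -scaleNr poly_momentD !poly_momentZ.
by rewrite !poly_moment_derivn_exp ?mulr0 ?addr0//; lia.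
Qed.

End Integrals.

(** * Calculus of uniform big-O estimates *)

Section BigO.
Variables (R : realType) (L : R) (W : forall n, 'I_n.+1 -> R -> Prop).
Implicit Types (f g : forall n, 'I_n.+1 -> R -> R).

Lemma mesh_size_gt0 n : 0 < L -> 0 < mesh_size L n.
Proof. by move=> L0; rewrite divr_gt0// ltr0n. Qed.

Lemma eq_unif_bigO q f g : (forall n j t, f n j t = g n j t) ->
  unif_bigO L W q f -> unif_bigO L W q g.
Proof.
by move=> fg [C [d [d0 H]]]; exists C, d; split=> // n j t; rewrite -fg; exact: H.
Qed.

(** The threshold is lowered to 1 because h ^ q <= h ^ q' needs h <= 1, and
    C is replaced by its absolute value because C may be negative when W has
    no triple with h below the threshold. *)
Lemma unif_bigO_weaken q q' f : 0 < L -> (q' <= q)%N ->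
  unif_bigO L W q f -> unif_bigO L W q' f.
Proof.
move=> L0 qq' [C [d [d0 H]]]; exists `|C|, (Num.min d 1); split.
  by rewrite lt_min d0 ltr01.
move=> n j t Wt; rewrite lt_min => /andP[hd h1].
have h0 := mesh_size_gt0 n L0.
apply: (le_trans (H n j t Wt hd)).
apply: (@le_trans _ _ (`|C| * mesh_size L n ^+ q)).
  by rewrite ler_wpM2r ?ler_norm// exprn_ge0// ltW.
by rewrite ler_wpM2l// ler_wiXn2l// ltW.
Qed.

Lemma unif_bigO0 q : unif_bigO L W q (fun n j t => 0).
Proof.
by exists 0, 1; split=> // n j t _ _; rewrite normr0 mul0r.
Qed.

Lemma unif_bigOD q f g : unif_bigO L W q f -> unif_bigO L W q g ->
  unif_bigO L W q (fun n j t => f n j t + g n j t).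
Proof.
move=> [C [d [d0 H]]] [C' [d' [d0' H']]].
exists (C + C'), (Num.min d d'); split; first by rewrite lt_min d0.
move=> n j t Wt; rewrite lt_min => /andP[hd hd'].
by rewrite (le_trans (ler_normD _ _))// mulrDl lerD ?H ?H'.
Qed.

Lemma unif_bigOZ q K f : unif_bigO L W q f ->
  unif_bigO L W q (fun n j t => f n j t * K).
Proof.
move=> [C [d [d0 H]]]; exists (C * `|K|), d; split=> // n j t Wt hd.
by rewrite normrM mulrAC ler_wpM2r// H.
Qed.

(** In the moment of the expansion every term is an unknown coefficient f
    times a number K; the order of f matters only where orthogonality does
    not make K zero. *)
Lemma unif_bigO_vanishing q q' K f : 0 < L -> (K != 0 -> (q' <= q)%N) ->
  unif_bigO L W q f -> unif_bigO L W q' (fun n j t => f n j t * K).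
Proof.
move=> L0; have [->|K0] := eqVneq K 0 => qq' fO.
  by apply: eq_unif_bigO (unif_bigO0 q') => n j t; rewrite mulr0.
exact/unif_bigOZ/(unif_bigO_weaken L0 (qq' isT)).
Qed.

Lemma unif_bigO_sum q (I : eqType) (r : seq I)
    (F : I -> forall n, 'I_n.+1 -> R -> R) :
  (forall i, i \in r -> unif_bigO L W q (F i)) ->
  unif_bigO L W q (fun n j t => \sum_(i <- r) F i n j t).
Proof.
elim: r => [|i r IH] HF.
  by apply: eq_unif_bigO (unif_bigO0 q) => n j t; rewrite big_nil.
apply: (@eq_unif_bigO _ (fun n j t => F i n j t + \sum_(k <- r) F k n j t)).
  by move=> n j t; rewrite big_cons.
apply: unif_bigOD; first by apply: HF; rewrite mem_head.
by apply: IH => k kr; apply: HF; rewrite in_cons kr orbT.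
Qed.

Lemma unif_bigO_moment q m (f : forall n, 'I_n.+1 -> R -> R -> R) :
  (forall n j t, continuous (fun xi => f n j xi t)) ->
  unif_bigO_xi L W q f ->
  unif_bigO L W q (fun n j t =>
    \int[lebesgue_measure]_(xi in `[(-1 : R), 1])
       (f n j xi t * (legendre R m).[xi])).
Proof.
move=> cf [C [d [d0 H]]].
exists (C * (\sum_(i < size (legendre R m)) `|(legendre R m)`_i|) * 2), d.
split=> // n j t Wt hd.
rewrite mulrAC [X in _ <= X * _](mulrAC C) norm_Rintegral_le//.
  move=> x; apply: cvgM; [exact: cf|exact: continuous_horner].
move=> xi hxi; rewrite normrM ler_pM// ?H//; exact: norm_horner_le.
Qed.

End BigO.

(** * The moments of the error *)

Lemma continuous_dg_error (R : realType) (p : nat) (x0 L : R) (u : R -> R -> R) n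
    (c : 'I_n.+1 -> 'I_p.+1 -> R -> R) j t :
  smooth u -> continuous (fun xi => dg_error x0 L u c j xi t).
Proof.
move=> /(_ 0)[cu _] xi; rewrite /dg_error; apply: cvgB.
  exact: continuous_horner.
have := cu (cell_map x0 L j xi, t).
apply: (@continuous_comp _ _ _ (fun xi => (cell_map x0 L j xi, t)) (fun z => u z.1 z.2)).
have cm : {for xi, continuous (cell_map x0 L j)}.
  apply: cvgD; first exact: cvg_cst.
  by apply: cvgM; [exact: cvg_cst|exact: cvg_id].
exact: (cvg_pair cm (cvg_cst t)).
Qed.

Theorem corollary3 (R : realType) (p : nat) (a x0 L : R) (u : R -> R -> R)
    (c : forall n : nat, 'I_n.+1 -> 'I_p.+1 -> R -> R)
    (alpha : forall n : nat, 'I_n.+1 -> nat -> R -> R)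
    (W : forall n : nat, 'I_n.+1 -> R -> Prop)
    (a_gt0 : 0 < a) (L_gt0 : 0 < L)
    (u_sol : smooth_periodic_advection a L u)
    (c_sol : forall n : nat, dg_solution a L (c n))
    (W_ge0 : forall (n : nat) (j : 'I_n.+1) (t : R), W n j t -> 0 <= t)
    (accuracy : unif_bigO_xi L W p.+1
       (fun n j xi t => dg_error x0 L u (c n) j xi t))
    (jump_order : unif_bigO L W p.+1 (fun n j t => jump (c n) j t))
    (alpha_order : forall k : nat, (p + 2 <= k <= 2 * p + 1)%N ->
       unif_bigO L W k (fun n j t => alpha n j k t))
    (superconvergent_form : unif_bigO_xi L W (2 * p + 1)
       (fun n j xi t =>
          dg_error x0 L u (c n) j xi t
          - ((-1) ^+ p.+1 / 2 * jump (c n) j t * (radau R p).[xi]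
             + \sum_(1 <= k < p.+1)
                 alpha n j (p + 1 + k)%N t * radau_int p k xi))) :
  forall m : nat, (m <= p)%N ->
    unif_bigO L W (2 * p + 1 - m)
      (fun n j t =>
         \int[lebesgue_measure]_(xi in `[(-1 : R), 1])
           (dg_error x0 L u (c n) j xi t * (legendre R m).[xi])).
Proof.
move=> m mp.
have [u_smooth _ _] := u_sol.
(* The leading part of the error, with each iterated integral replaced by the
   polynomial that it equals on [-1, 1]: this makes it continuous in xi. *)
pose F n (j : 'I_n.+1) t : {poly R} :=
  ((-1) ^+ p.+1 / 2 * jump (c n) j t) *: radau_poly R p 0
  + \sum_(1 <= k < p.+1) alpha n j (p + 1 + k)%N t *: radau_poly R p k.
have bigO_rem : unif_bigO L W (2 * p + 1 - m) (fun n j t =>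
    \int[lebesgue_measure]_(xi in `[(-1 : R), 1])
      ((dg_error x0 L u (c n) j xi t - (F n j t).[xi]) * (legendre R m).[xi])).
  apply: (unif_bigO_weaken L_gt0 (leq_subr m _)).
  apply: (@unif_bigO_moment _ _ _ _ _ (fun n j xi t =>
    dg_error x0 L u (c n) j xi t - (F n j t).[xi])).
    move=> n j t xi.
    apply: cvgB; [exact: continuous_dg_error|exact: continuous_horner].
  have [C [d [d0 H]]] := superconvergent_form.
  exists C, d; split=> // n j t Wt hd xi hxi.
  rewrite /F hornerD hornerZ horner_sum radau_poly0.
  under eq_big_nat => k kp.
    rewrite hornerZ -radau_int_horner; [over|lia|lra].
  exact: H.
have orth k : poly_moment m (radau_poly R p k) != 0 -> (p <= m + k)%N.
  by move=> nz; rewrite leqNgt; apply: contra nz => /poly_moment_radau ->.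
have bigO_F : unif_bigO L W (2 * p + 1 - m)
    (fun n j t => poly_moment m (F n j t)).
  apply: (@eq_unif_bigO _ _ _ _ (fun n j t =>
     jump (c n) j t * ((-1) ^+ p.+1 / 2 * poly_moment m (radau_poly R p 0))
     + \sum_(k <- index_iota 1 p.+1)
         alpha n j (p + 1 + k)%N t * poly_moment m (radau_poly R p k))).
    move=> n j t; rewrite [RHS]poly_momentD poly_momentZ poly_moment_sum mulrA.
    congr (_ * _ + _); first by rewrite mulrC.
    by apply: eq_bigr => k _; rewrite poly_momentZ.
  apply: unif_bigOD.
    apply: (unif_bigO_vanishing L_gt0 _ jump_order).
    by rewrite mulf_eq0 negb_or => /andP[_ /orth]; lia.
  apply: unif_bigO_sum => k; rewrite mem_index_iota => kp.
  apply: (unif_bigO_vanishing L_gt0 (q := (p + 1 + k)%N)).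
    by move=> /orth; lia.
  by apply: alpha_order; lia.
apply: eq_unif_bigO (unif_bigOD bigO_rem bigO_F) => n j t.
rewrite /poly_moment -RintegralD//.
- by apply: eq_Rintegral => xi _; rewrite hornerM; ring.
- apply: continuous_integrable_segment => xi.
  apply: cvgM; last exact: continuous_horner.
  by apply: cvgB; [exact: continuous_dg_error|exact: continuous_horner].
- exact/continuous_integrable_segment/continuous_horner.
Qed.
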